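(* Let $\alpha,\lambda\in\mathbb{R}$ with $\alpha\neq 0$, let $I,J\subset\mathbb{R}$ be open intervals and let $f:I\to\mathbb{R}$, $g:J\to\mathbb{R}$ be smooth functions. Suppose that the surface $M=\{(x,y,z)\in\mathbb{R}^3: x\in I,\ y\in J,\ z=f(x)+g(y)\}$ is an $\alpha$-self-similar solution of constant $\lambda$. Then $f$ or $g$ is a linear function (i.e. of the form $t\mapsto at+b$ with $a,b\in\mathbb{R}$). In particular, the surface is cylindrical. Moreover, after a linear isometry of $\mathbb{R}^3$, the surface is given by $z=f(x)+g(y)$ with $g(y)=0$ and with $f$ (the function describing the surface after the isometry) satisfying $$\frac{f''(x)}{(1+f'(x)^2)^{3/2}}=\alpha\,\frac{-xf'(x)+f(x)}{\sqrt{1+f'(x)^2}}+\lambda .$$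
   Context: $(x,y,z)$ are the canonical coordinates of Euclidean space $\mathbb{R}^3$ with metric $\langle\cdot,\cdot\rangle$. A surface $M\subset\mathbb{R}^3$ with Gauss map (unit normal field) $N$ is an $\alpha$-self-similar solution of constant $\lambda$ if $H(\mathbf{x})=\alpha\langle N(\mathbf{x}),\mathbf{x}\rangle+\lambda$ for all $\mathbf{x}\in M$, where $\mathbf{x}$ is the position vector and $H$ is the mean curvature, i.e. the trace of the second fundamental form (not divided by 2), with the sign convention that a sphere of radius $r>0$ has $H=2/r$ with respect to the inward normal. For a graph $z=u(x,y)$ the unit normal is taken to be $N=(-u_x,-u_y,1)/\sqrt{1+|Du|^2}$, so the condition reads $$\mathrm{div}\frac{Du}{\sqrt{1+|Du|^2}}=\alpha\,\frac{u-\langle (x,y),Du\rangle}{\sqrt{1+|Du|^2}}+\lambda .$$ For $u(x,y)=f(x)+g(y)$ this is $$\frac{(1+g'^2)f''+(1+f'^2)g''}{(1+f'^2+g'^2)^{3/2}}=\alpha\,\frac{-xf'-yg'+f+g}{\sqrt{1+f'^2+g'^2}}+\lambda .$$ A surface is cylindrical if it is a ruled surface, i.e. locally parametrized by $X(s,t)=\gamma(s)+t\beta(s)$ with $\gamma,\beta$ smooth curves in $\mathbb{R}^3$ and $|\beta|=1$, whose rulings are all parallel to a fixed direction ($\beta$ constant). The defining equation is invariant under linear isometries of $\mathbb{R}^3$ (with the normal transported by the isometry). Surfaces are considered locally, so a graph over a domain of the plane is regarded as (a part of) the surface given by the same formula. *)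

(* Defs.v *)
From Stdlib Require Import Reals.
From Coquelicot Require Import Coquelicot.
Open Scope R_scope.

(* Coquelicot's product norm is the l2 norm, so [norm] on R3 is the Euclidean
   norm associated with [dot]. *)
Definition R3 : Type := (R * R * R)%type.

Definition cx (p : R3) : R := fst (fst p).
Definition cy (p : R3) : R := snd (fst p).
Definition cz (p : R3) : R := snd p.

Definition dot (u v : R3) : R := cx u * cx v + cy u * cy v + cz u * cz v.

Definition linear_isometry (Phi : R3 -> R3) : Prop :=
  is_linear Phi /\ forall u : R3, norm (Phi u) = norm u.

(* Nonempty, with endpoints possibly infinite. *)
Definition is_open_interval (I : R -> Prop) : Prop :=
  exists a b : Rbar, Rbar_lt a b /\
    forall x : R, I x <-> Rbar_lt a x /\ Rbar_lt x b.

(* Functions on a subset of R or R^2 are total functions of which only the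
   restriction is constrained; the subset being open, derivatives there do not
   depend on the extension. *)
Definition smooth_on (I : R -> Prop) (f : R -> R) : Prop :=
  forall (n : nat) (x : R), I x -> ex_derive_n f n x.

Definition smooth_on2 (W : R * R -> Prop) (f : R -> R -> R) : Prop :=
  forall (n : nat) (s t : R), W (s, t) -> ex_diff_n f n s t.

Definition smooth_curve (I : R -> Prop) (c : R -> R3) : Prop :=
  smooth_on I (fun s => cx (c s)) /\
  smooth_on I (fun s => cy (c s)) /\
  smooth_on I (fun s => cz (c s)).

Definition linear_on (I : R -> Prop) (f : R -> R) : Prop :=
  exists a b : R, forall t : R, I t -> f t = a * t + b.

Definition rect (I J : R -> Prop) (q : R * R) : Prop := I (fst q) /\ J (snd q).

Definition D1 (X : R -> R -> R3) (s t : R) : R3 :=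
  (Derive (fun r => cx (X r t)) s,
   Derive (fun r => cy (X r t)) s,
   Derive (fun r => cz (X r t)) s).

Definition D2 (X : R -> R -> R3) (s t : R) : R3 :=
  (Derive (fun r => cx (X s r)) t,
   Derive (fun r => cy (X s r)) t,
   Derive (fun r => cz (X s r)) t).

(* The last clause says that X maps open subsets of W to relatively open
   subsets of M; with smoothness and injectivity, X is a homeomorphism from W
   onto an open part of M. *)
Definition local_param (M : R3 -> Prop) (W : R * R -> Prop)
    (X : R -> R -> R3) : Prop :=
  open W /\
  (smooth_on2 W (fun s t => cx (X s t)) /\
   smooth_on2 W (fun s t => cy (X s t)) /\
   smooth_on2 W (fun s t => cz (X s t))) /\
  (forall s t : R, W (s, t) -> forall a b : R,
     plus (scal a (D1 X s t)) (scal b (D2 X s t)) = (zero : R * R * R) ->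
     a = 0 /\ b = 0) /\
  (forall s t s' t' : R, W (s, t) -> W (s', t') ->
     X s t = X s' t' -> s = s' /\ t = t') /\
  (forall O : R * R -> Prop, open O -> (forall q, O q -> W q) ->
     exists V : R * R * R -> Prop, open V /\
       forall p : R3, (exists s t : R, O (s, t) /\ X s t = p) <-> M p /\ V p).

Definition regular_surface (M : R3 -> Prop) : Prop :=
  forall p : R3, M p ->
    exists (W : R * R -> Prop) (X : R -> R -> R3) (s t : R),
      local_param M W X /\ W (s, t) /\ X s t = p.

Definition gauss_map (M : R3 -> Prop) (N : R3 -> R3) : Prop :=
  continuous_on (M : R * R * R -> Prop) (N : R * R * R -> R * R * R) /\
  (forall p : R3, M p -> norm (N p) = 1) /\
  (forall (W : R * R -> Prop) (X : R -> R -> R3), local_param M W X ->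
     forall s t : R, W (s, t) ->
       dot (N (X s t)) (D1 X s t) = 0 /\ dot (N (X s t)) (D2 X s t) = 0).

(* Trace of the second fundamental form of X with respect to the unit normal n
   at X s t: the trace of (first form)^-1 (second form), not halved, where the
   second form has entries <X_ij, n>. A sphere of radius r has mean curvature
   2 / r for the inward normal. *)
Definition mean_curvature (X : R -> R -> R3) (n : R3) (s t : R) : R :=
  let E := dot (D1 X s t) (D1 X s t) in
  let F := dot (D1 X s t) (D2 X s t) in
  let G := dot (D2 X s t) (D2 X s t) in
  let L11 := dot (D1 (D1 X) s t) n in
  let L12 := dot (D2 (D1 X) s t) n in
  let L22 := dot (D2 (D2 X) s t) n in
  (L11 * G - 2 * L12 * F + L22 * E) / (E * G - F ^ 2).

(* The mean curvature at a point does not depend on the local parametrization;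
   the equation is required in all of them. *)
Definition self_similar (alpha lambda : R) (M : R3 -> Prop) (N : R3 -> R3)
    : Prop :=
  regular_surface M /\ gauss_map M N /\
  forall (W : R * R -> Prop) (X : R -> R -> R3), local_param M W X ->
    forall s t : R, W (s, t) ->
      mean_curvature X (N (X s t)) s t
        = alpha * dot (N (X s t)) (X s t) + lambda.

Definition graph (W : R * R -> Prop) (u : R -> R -> R) (p : R3) : Prop :=
  W (cx p, cy p) /\ cz p = u (cx p) (cy p).

Definition graph_normal (u : R -> R -> R) (p : R3) : R3 :=
  let ux := Derive (fun r => u r (cy p)) (cx p) in
  let uy := Derive (fun r => u (cx p) r) (cy p) in
  let w := sqrt (1 + (ux ^ 2 + uy ^ 2)) in
  (- ux / w, - uy / w, 1 / w).

Definition sum_fun (f g : R -> R) (x y : R) : R := f x + g y.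

Definition ruled_map (gamma beta : R -> R3) (s t : R) : R3 :=
  plus (gamma s : R * R * R) (scal t (beta s : R * R * R)).

Definition ruled_param (M : R3 -> Prop) (S T : R -> Prop)
    (gamma beta : R -> R3) : Prop :=
  is_open_interval S /\ is_open_interval T /\
  smooth_curve S gamma /\ smooth_curve S beta /\
  (forall s : R, S s -> norm (beta s) = 1) /\
  local_param M (rect S T) (ruled_map gamma beta).

(* Ruled, with all the rulings parallel to a fixed direction w. *)
Definition cylindrical (M : R3 -> Prop) : Prop :=
  exists w : R3, forall p : R3, M p ->
    exists (S T : R -> Prop) (gamma beta : R -> R3),
      ruled_param M S T gamma beta /\
      (forall s : R, S s -> beta s = w) /\
      exists s t : R, S s /\ T t /\ ruled_map gamma beta s t = p.

Definition image (Phi : R3 -> R3) (M : R3 -> Prop) (p : R3) : Prop :=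
  exists q : R3, M q /\ Phi q = p.

(* Main.v *)
Require Import Defs.
From Stdlib Require Import Reals Lra Classical FunctionalExtensionality.
From Coquelicot Require Import Coquelicot.
Open Scope R_scope.

(** Write p = f', q = g', P = p^2, A = f - x p, B = g - y q, S = 1 + p^2 + q^2.
    Evaluated in the chart (x, y) |-> (x, y, f x + g y) and cleared of
    denominators, self-similarity becomes
      (E)   (1 + q^2) p' + (1 + p^2) q' = alpha (A + B) S + lambda S sqrt S,
    which is symmetric in the two variables.

    Suppose that neither f nor g is linear. Then there are nonempty open sets
    of x with p p' <> 0 and of y with q q' <> 0
    ([linear_or_curved], [open_curved_part]). The y-derivative of (E) divided
    by q q' reads
      3 lambda sqrt S = 2 (p' - alpha A) + (affine function of P),
    with coefficients that depend on y only. Subtracting two values of y shows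
    that lambda (sqrt (c1 + P) - sqrt (c0 + P)) is affine in P, where
    c = 1 + q^2. Two differentiations in P forbid this unless c0 = c1
    ([sqrt_difference_affine]); since q^2 is not locally constant, lambda = 0.

    With lambda = 0 and y fixed, that relation and (E) become
      p' = alpha A + u + v P,     alpha A P = s + t P.
    As A' = - x p', two differentiations of the second relation give
    p = - 3 x p' and alpha x p^3 = 2 s. Putting these into the first one leaves
    a cubic equation for P with leading coefficient alpha. Since P is not
    locally constant, alpha = 0, a contradiction
    ([no_curved_profile_solves_both]).

    If g y = a y + b, the surface is a union of parts of lines of direction (0, 1, a),
    and the rotation [tilt a] about the x-axis takes this direction to the
    y-axis. The surface becomes z = (f x + b) / sqrt (1 + a^2) over an open set,
    and (E) with q = a, q' = 0 is the profile equation after rescaling. If f is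
    linear instead, exchanging x and y by the isometry [swap] gives this case. *)

(** * Open intervals and zero derivatives *)

Lemma derivative_of_locally_zero :
  forall (U : R -> Prop) (h : R -> R) (x l : R),
    open U -> U x -> (forall t, U t -> h t = 0) -> is_derive h x l -> l = 0.
Proof.
  intros U h x l HU Ux Hh Hd.
  assert (H0 : is_derive h x 0).
  { apply (is_derive_ext_loc (fun _ => 0)).
    - apply (filter_imp U); [ intros t Ht; symmetry; auto | now apply HU ].
    - apply (@is_derive_const R_AbsRing R_NormedModule). }
  rewrite <- (is_derive_unique _ _ _ Hd). now apply is_derive_unique.
Qed.

Lemma constant_on_interval :
  forall (I : R -> Prop) (h : R -> R),
    is_open_interval I -> (forall x, I x -> is_derive h x 0) ->
    forall x y, I x -> I y -> h x = h y.
Proof.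
  intros I h (a & b & _ & HI) Hd.
  assert (Hlt : forall x y, I x -> I y -> x < y -> h x = h y).
  { intros x y Ix Iy Hxy. apply (eq_is_derive h x y); [ | exact Hxy ].
    intros t Ht. apply Hd. apply HI in Ix, Iy. apply HI.
    destruct Ix as [Hax _], Iy as [_ Hyb]. split.
    - apply (Rbar_lt_le_trans a x t); [ exact Hax | simpl; lra ].
    - apply (Rbar_le_lt_trans t y b); [ simpl; lra | exact Hyb ]. }
  intros x y Ix Iy. destruct (Rtotal_order x y) as [H | [H | H]].
  - now apply Hlt.
  - now subst.
  - symmetry. now apply Hlt.
Qed.

Lemma open_interval_open :
  forall I : R -> Prop, is_open_interval I -> open I.
Proof.
  intros I (a & b & _ & HI).
  apply (open_ext (fun x : R => Rbar_lt a x /\ Rbar_lt x b)).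
  { intros x. symmetry. apply HI. }
  apply open_and; [ apply open_Rbar_gt | apply open_Rbar_lt ].
Qed.

Lemma open_interval_scale :
  forall (J : R -> Prop) (k : R),
    0 < k -> is_open_interval J -> is_open_interval (fun t => J (t * / k)).
Proof.
  intros J k Hk (a & b & Hab & HJ).
  assert (Hl : forall x t : R, x < t * / k <-> k * x < t).
  { intros x t. split; intros H.
    - apply (Rmult_lt_compat_l k) in H; [ | exact Hk ].
      replace (k * (t * / k)) with t in H by (field; lra). exact H.
    - apply (Rmult_lt_reg_l k); [ exact Hk | ].
      replace (k * (t * / k)) with t by (field; lra). exact H. }
  assert (Hr : forall x t : R, t * / k < x <-> t < k * x).
  { intros x t. split; intros H.
    - apply (Rmult_lt_compat_l k) in H; [ | exact Hk ].
      replace (k * (t * / k)) with t in H by (field; lra). exact H.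
    - apply (Rmult_lt_reg_l k); [ exact Hk | ].
      replace (k * (t * / k)) with t by (field; lra). exact H. }
  exists (match a with Finite x => Finite (k * x) | _ => a end),
         (match b with Finite x => Finite (k * x) | _ => b end).
  split.
  - destruct a, b; simpl in *; auto. now apply Rmult_lt_compat_l.
  - intros t. rewrite HJ. destruct a, b; simpl; rewrite ?Hl, ?Hr; tauto.
Qed.

Lemma open_interval_inhabited :
  forall J : R -> Prop, is_open_interval J -> exists y, J y.
Proof.
  intros J (a & b & Hab & HJ).
  destruct a as [a | | ], b as [b | | ]; simpl in Hab; try easy.
  - exists ((a + b) / 2). apply HJ. simpl. lra.
  - exists (a + 1). apply HJ. simpl. lra.
  - exists (b - 1). apply HJ. simpl. lra.
  - exists 0. apply HJ. simpl. easy.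
Qed.

(** * Two curved profiles are incompatible *)

(** Every differentiation in x brings out a common factor p p', so dividing by
    it amounts to differentiating with respect to p^2. One step turns the
    relation into the constancy of 1/sqrt(c1 + p^2) - 1/sqrt(c0 + p^2), and a
    second one into the equality of the inverse cubes of the two roots. *)
Lemma sqrt_difference_affine :
  forall (U : R -> Prop) (p p1 : R -> R) (c0 c1 m n x0 : R),
    open U -> U x0 ->
    (forall x, U x -> is_derive p x (p1 x)) ->
    (forall x, U x -> p x * p1 x <> 0) ->
    0 < c0 -> 0 < c1 ->
    (forall x, U x ->
       sqrt (c1 + p x ^ 2) - sqrt (c0 + p x ^ 2) = m + n * p x ^ 2) ->
    c0 = c1.
Proof.
  intros U p p1 c0 c1 m n x0 HU Ux0 Hp Hpp1 Hc0 Hc1 Heq.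
  assert (Hs : forall c x, 0 < c -> 0 < sqrt (c + p x ^ 2)).
  { intros c x Hc. apply sqrt_lt_R0. generalize (pow2_ge_0 (p x)). lra. }
  assert (H1 : forall x, U x ->
    / sqrt (c1 + p x ^ 2) - / sqrt (c0 + p x ^ 2) - 2 * n = 0).
  { intros x Ux.
    apply (Rmult_eq_reg_l (p x * p1 x)); [ rewrite Rmult_0_r | now apply Hpp1 ].
    apply (derivative_of_locally_zero U
      (fun x => sqrt (c1 + p x ^ 2) - sqrt (c0 + p x ^ 2) - (m + n * p x ^ 2)) x);
      [ exact HU | exact Ux | intros t Ut; rewrite Heq by exact Ut; ring | ].
    generalize (Hs c0 x Hc0) (Hs c1 x Hc1) (pow2_ge_0 (p x)).
    intros Hs0 Hs1 Hp2.
    auto_derive.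
    - repeat split; try lra; eexists; now apply Hp.
    - replace (Derive (fun x : R => p x) x) with (p1 x)
        by (symmetry; apply is_derive_unique; auto).
      simpl in *. field. lra. }
  assert (H2 : / sqrt (c1 + p x0 ^ 2) ^ 3 - / sqrt (c0 + p x0 ^ 2) ^ 3 = 0).
  { apply (Rmult_eq_reg_l (- (p x0 * p1 x0)));
      [ rewrite Rmult_0_r | generalize (Hpp1 x0 Ux0); lra ].
    apply (derivative_of_locally_zero U _ x0 _ HU Ux0 H1).
    generalize (Hs c0 x0 Hc0) (Hs c1 x0 Hc1) (pow2_ge_0 (p x0)).
    intros Hs0 Hs1 Hp2.
    auto_derive.
    - repeat split; try lra; try (eexists; now apply Hp); simpl in *; lra.
    - replace (Derive (fun x : R => p x) x0) with (p1 x0)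
        by (symmetry; apply is_derive_unique; auto).
      simpl. field. simpl in *; lra. }
  generalize (Hs c0 x0 Hc0) (Hs c1 x0 Hc1) (pow2_ge_0 (p x0)).
  intros Hs0 Hs1 Hp2.
  assert (H3 : sqrt (c1 + p x0 ^ 2) ^ 3 = sqrt (c0 + p x0 ^ 2) ^ 3).
  { apply Rinv_eq_reg. lra. }
  assert (H4 : sqrt (c1 + p x0 ^ 2) = sqrt (c0 + p x0 ^ 2)).
  { revert H3 Hs0 Hs1. generalize (sqrt (c1 + p x0 ^ 2)) (sqrt (c0 + p x0 ^ 2)).
    intros r s H3 Hs' Hr.
    assert (Hf : (r - s) * (r ^ 2 + r * s + s ^ 2) = 0) by (ring_simplify; lra).
    apply Rmult_integral in Hf. destruct Hf as [Hf | Hf]; [ lra | nra ]. }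
  apply sqrt_inj in H4; lra.
Qed.

(** The two relations, valid on a common open set, determine p through
    p = - 3 x p' and alpha x p^3 = 2 s; the first of them then becomes a
    polynomial equation in p^2 of degree 3, which three differentiations with
    respect to p^2 reduce to its leading coefficient, a multiple of alpha. *)
Lemma no_curved_profile_solves_both :
  forall (U : R -> Prop) (f p p1 : R -> R) (alpha u v s t x0 : R),
    alpha <> 0 -> open U -> U x0 ->
    (forall x, U x -> is_derive f x (p x)) ->
    (forall x, U x -> is_derive p x (p1 x)) ->
    (forall x, U x -> p x * p1 x <> 0) ->
    (forall x, U x ->
       p1 x = alpha * (f x - x * p x) + u + v * p x ^ 2) ->
    (forall x, U x ->
       alpha * (f x - x * p x) * p x ^ 2 = s + t * p x ^ 2) ->
    False.
Proof.
  intros U f p p1 alpha u v s t x0 Ha HU Ux0 Hf Hp Hpp1 Hode Hsup.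
  assert (Ef : forall x, U x -> ex_derive f x) by (eexists; now apply Hf).
  assert (Ep : forall x, U x -> ex_derive p x) by (eexists; now apply Hp).
  assert (Df : forall x, U x -> Derive (fun x : R => f x) x = p x)
    by (intros; apply is_derive_unique; auto).
  assert (Dp : forall x, U x -> Derive (fun x : R => p x) x = p1 x)
    by (intros; apply is_derive_unique; auto).
  assert (H1 : forall x, U x ->
    2 * alpha * (f x - x * p x) - alpha * x * p x - 2 * t = 0).
  { intros x Ux.
    apply (Rmult_eq_reg_l (p x * p1 x)); [ rewrite Rmult_0_r | now apply Hpp1 ].
    apply (derivative_of_locally_zero U (fun x =>
      alpha * (f x - x * p x) * p x ^ 2 - (s + t * p x ^ 2)) x);
      [ exact HU | exact Ux | intros y Uy; rewrite Hsup by exact Uy; ring | ].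
    auto_derive; [ repeat split; auto | rewrite Df, Dp by exact Ux; ring ]. }
  assert (H2 : forall x, U x -> p x + 3 * x * p1 x = 0).
  { intros x Ux.
    apply (Rmult_eq_reg_l (- alpha)); [ rewrite Rmult_0_r | lra ].
    apply (derivative_of_locally_zero U _ x _ HU Ux H1).
    auto_derive; [ repeat split; auto | rewrite Df, Dp by exact Ux; ring ]. }
  (* eliminate A between the hypothesis on alpha A P and its derivative *)
  assert (H3 : forall x, U x -> alpha * x * p x ^ 3 = 2 * s).
  { intros x Ux.
    replace (alpha * x * p x ^ 3) with
      (2 * (alpha * (f x - x * p x) * p x ^ 2) - 2 * t * p x ^ 2
       - (2 * alpha * (f x - x * p x) - alpha * x * p x - 2 * t) * p x ^ 2) by ring.
    rewrite Hsup, H1 by exact Ux. ring. }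
  (* p^2 times the formula for p' makes the left-hand side
     alpha p^5 (p + 3 x p'), once 2 s is written as alpha x p^3 *)
  assert (H4 : forall x, U x -> alpha * p x ^ 6
      + 6 * s * (s + (t + u) * p x ^ 2 + v * p x ^ 4) = 0).
  { intros x Ux.
    replace (s + (t + u) * p x ^ 2 + v * p x ^ 4) with (p1 x * p x ^ 2).
    - replace (6 * s) with (3 * (alpha * x * p x ^ 3)) by (rewrite H3 by exact Ux; ring).
      replace (alpha * p x ^ 6 + 3 * (alpha * x * p x ^ 3) * (p1 x * p x ^ 2))
        with (alpha * p x ^ 5 * (p x + 3 * x * p1 x)) by ring.
      rewrite H2 by exact Ux. ring.
    - rewrite Hode by exact Ux.
      replace (s + (t + u) * p x ^ 2 + v * p x ^ 4)
        with ((s + t * p x ^ 2) + u * p x ^ 2 + v * p x ^ 4) by ring.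
      rewrite <- Hsup by exact Ux. ring. }
  assert (H5 : forall x, U x ->
    3 * alpha * p x ^ 4 + 6 * s * ((t + u) + 2 * v * p x ^ 2) = 0).
  { intros x Ux.
    apply (Rmult_eq_reg_l (2 * (p x * p1 x)));
      [ rewrite Rmult_0_r | generalize (Hpp1 x Ux); lra ].
    apply (derivative_of_locally_zero U _ x _ HU Ux H4).
    auto_derive; [ repeat split; auto | rewrite Dp by exact Ux; ring ]. }
  assert (H6 : forall x, U x -> 6 * alpha * p x ^ 2 + 12 * s * v = 0).
  { intros x Ux.
    apply (Rmult_eq_reg_l (2 * (p x * p1 x)));
      [ rewrite Rmult_0_r | generalize (Hpp1 x Ux); lra ].
    apply (derivative_of_locally_zero U _ x _ HU Ux H5).
    auto_derive; [ repeat split; auto | rewrite Dp by exact Ux; ring ]. }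
  apply Ha.
  apply (Rmult_eq_reg_l (12 * (p x0 * p1 x0)));
    [ rewrite Rmult_0_r | generalize (Hpp1 x0 Ux0); lra ].
  apply (derivative_of_locally_zero U _ x0 _ HU Ux0 H6).
  auto_derive; [ repeat split; auto | rewrite Dp by exact Ux0; ring ].
Qed.

(** The equation is differentiated in y only. At a fixed y, the equation and
    its y-derivative are relations between x, f, f' and f'' with constant
    coefficients. Comparing the derivatives at two values of y gives lambda = 0;
    then the pair at a single y is contradictory. *)
Lemma no_two_curved_profiles :
  forall (U V : R -> Prop) (f p p1 g q q1 q2 : R -> R)
         (alpha lambda x0 y0 : R),
    alpha <> 0 -> open U -> U x0 -> open V -> V y0 ->
    (forall x, U x -> is_derive f x (p x)) ->
    (forall x, U x -> is_derive p x (p1 x)) ->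
    (forall y, V y -> is_derive g y (q y)) ->
    (forall y, V y -> is_derive q y (q1 y)) ->
    (forall y, V y -> is_derive q1 y (q2 y)) ->
    (forall x, U x -> p x * p1 x <> 0) ->
    (forall y, V y -> q y * q1 y <> 0) ->
    (forall x y, U x -> V y ->
       (1 + q y ^ 2) * p1 x + (1 + p x ^ 2) * q1 y
       = alpha * ((f x - x * p x) + (g y - y * q y)) * (1 + p x ^ 2 + q y ^ 2)
         + lambda * ((1 + p x ^ 2 + q y ^ 2) * sqrt (1 + p x ^ 2 + q y ^ 2))) ->
    False.
Proof.
  intros U V f p p1 g q q1 q2 alpha lambda x0 y0 Ha HU Ux0 HV Vy0
    Hf Hp Hg Hq Hq1 Hpp1 Hqq1 Heq.
  assert (Hy : forall x y, U x -> V y ->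
    2 * (q y * q1 y) * p1 x + (1 + p x ^ 2) * q2 y
    - alpha * (- y * q1 y) * (1 + p x ^ 2 + q y ^ 2)
    - 2 * alpha * ((f x - x * p x) + (g y - y * q y)) * (q y * q1 y)
    - 3 * lambda * sqrt (1 + p x ^ 2 + q y ^ 2) * (q y * q1 y) = 0).
  { intros x y Ux Vy.
    apply (derivative_of_locally_zero V (fun y =>
       (1 + q y ^ 2) * p1 x + (1 + p x ^ 2) * q1 y
       - (alpha * ((f x - x * p x) + (g y - y * q y)) * (1 + p x ^ 2 + q y ^ 2)
         + lambda * ((1 + p x ^ 2 + q y ^ 2) * sqrt (1 + p x ^ 2 + q y ^ 2)))) y);
      [ exact HV | exact Vy | intros z Vz; rewrite Heq by assumption; ring | ].
    assert (HS : 0 < 1 + p x ^ 2 + q y ^ 2)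
      by (generalize (pow2_ge_0 (p x)) (pow2_ge_0 (q y)); lra).
    assert (HT := sqrt_lt_R0 _ HS).
    assert (HTT := sqrt_sqrt _ (Rlt_le _ _ HS)).
    auto_derive.
    - repeat split; try (eexists; auto; fail); lra.
    - replace (Derive (fun y : R => q y) y) with (q1 y)
        by (symmetry; apply is_derive_unique; auto).
      replace (Derive (fun y : R => q1 y) y) with (q2 y)
        by (symmetry; apply is_derive_unique; auto).
      replace (Derive (fun y : R => g y) y) with (q y)
        by (symmetry; apply is_derive_unique; auto).
      simpl in HS, HT, HTT |- *. revert HS HT HTT.
      generalize (sqrt (1 + p x * (p x * 1) + q y * (q y * 1))).
      intros T HS HT HTT.
      (* the square root contributes S / (2 sqrt S), that is sqrt S / 2 *)
      assert (E : forall c, (1 + p x * (p x * 1) + q y * (q y * 1)) * (c * / (2 * T))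
                  = c * T / 2).
      { intros c. rewrite <- HTT. field. lra. }
      rewrite E. field. }
  assert (Hqy : forall y, V y -> q y <> 0 /\ q1 y <> 0).
  { intros y Vy. generalize (Hqq1 y Vy). intros H.
    split; intros E; apply H; rewrite E; ring. }
  pose (r := fun y => q2 y / (q y * q1 y)).
  pose (e := fun y => alpha * y / q y).
  pose (B := fun y => g y - y * q y).
  assert (Hdiv : forall x y, U x -> V y ->
    3 * lambda * sqrt (1 + q y ^ 2 + p x ^ 2)
    = 2 * p1 x + (1 + p x ^ 2) * r y + e y * (1 + p x ^ 2 + q y ^ 2)
      - 2 * alpha * ((f x - x * p x) + B y)).
  { intros x y Ux Vy. destruct (Hqy y Vy) as [Hq0 Hq10].
    apply (Rmult_eq_reg_r (q y * q1 y)); [ | now apply Hqq1 ].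
    replace (1 + q y ^ 2 + p x ^ 2) with (1 + p x ^ 2 + q y ^ 2) by ring.
    generalize (Hy x y Ux Vy). generalize (sqrt (1 + p x ^ 2 + q y ^ 2)).
    intros T HT. unfold r, e, B.
    apply Rminus_diag_uniq_sym. rewrite <- HT. field. auto. }
  assert (Hl : lambda = 0).
  { destruct (Req_dec lambda 0) as [ | Hl ]; [ assumption | exfalso ].
    apply (Hqq1 y0 Vy0). apply (Rmult_eq_reg_l 2); [ | lra ]. rewrite Rmult_0_r.
    apply (derivative_of_locally_zero V (fun y => q y ^ 2 - q y0 ^ 2) y0);
      [ exact HV | exact Vy0 | | ].
    - intros y Vy.
      assert (H : 1 + q y0 ^ 2 = 1 + q y ^ 2); [ | lra ].
      apply (sqrt_difference_affine U p p1 _ _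
        ((r y - r y0 + e y * (1 + q y ^ 2) - e y0 * (1 + q y0 ^ 2)
          - 2 * alpha * (B y - B y0)) / (3 * lambda))
        ((r y - r y0 + e y - e y0) / (3 * lambda)) x0 HU Ux0 Hp Hpp1).
      + generalize (pow2_ge_0 (q y0)); lra.
      + generalize (pow2_ge_0 (q y)); lra.
      + intros x Ux. apply (Rmult_eq_reg_l (3 * lambda)); [ | lra ].
        rewrite Rmult_minus_distr_l, !Hdiv by assumption. field. exact Hl.
    - auto_derive; [ eexists; auto | ].
      replace (Derive (fun y : R => q y) y0) with (q1 y0)
        by (symmetry; apply is_derive_unique; auto).
      ring. }
  subst lambda.
  pose (u := (- r y0 - e y0 * (1 + q y0 ^ 2) + 2 * alpha * B y0) / 2).
  pose (v := (- r y0 - e y0) / 2).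
  assert (Hode : forall x, U x -> p1 x = alpha * (f x - x * p x) + u + v * p x ^ 2).
  { intros x Ux. generalize (Hdiv x y0 Ux Vy0). unfold u, v. intros H. lra. }
  apply (no_curved_profile_solves_both U f p p1 alpha u v
    ((1 + q y0 ^ 2) * u + q1 y0 - alpha * B y0 * (1 + q y0 ^ 2))
    ((1 + q y0 ^ 2) * v + q1 y0 - alpha * B y0) x0); auto.
  intros x Ux. generalize (Heq x y0 Ux Vy0). rewrite Hode by exact Ux.
  fold (B y0). intros H. lra.
Qed.

(** If f' f'' vanishes on the interval, then f'^2 is constant: where it is zero
    f' vanishes identically, where it is not f'' does. Both ways f'' = 0. *)
Lemma linear_or_curved :
  forall (I : R -> Prop) (f : R -> R),
    is_open_interval I -> smooth_on I f ->
    linear_on I f \/ exists x, I x /\ Derive f x * Derive_n f 2 x <> 0.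
Proof.
  intros I f HI Hf.
  destruct (classic (exists x, I x /\ Derive f x * Derive_n f 2 x <> 0))
    as [ | Hno ]; [ now right | left ].
  assert (HIo := open_interval_open I HI).
  assert (Df : forall x, I x -> is_derive f x (Derive f x)).
  { intros x Ix. apply Derive_correct. exact (Hf 1%nat x Ix). }
  assert (Dp : forall x, I x -> is_derive (Derive f) x (Derive_n f 2 x)).
  { intros x Ix. apply (Derive_correct (Derive f)). exact (Hf 2%nat x Ix). }
  assert (H0 : forall x, I x -> Derive f x * Derive_n f 2 x = 0).
  { intros x Ix. apply NNPP. intros H. apply Hno. now exists x. }
  assert (Hsq : forall x y, I x -> I y -> Derive f x ^ 2 = Derive f y ^ 2).
  { apply (constant_on_interval I (fun x => Derive f x ^ 2) HI). intros x Ix.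
    replace 0 with (2 * (Derive f x * Derive_n f 2 x)) by (rewrite H0; auto; ring).
    generalize (Dp x Ix). generalize (Derive_n f 2 x) (Derive f).
    intros l p Hp. auto_derive; [ now exists l | ].
    replace (Derive (fun x : R => p x) x) with l
      by (symmetry; now apply is_derive_unique).
    ring. }
  assert (H2 : forall x, I x -> Derive_n f 2 x = 0).
  { intros x Ix. destruct (Req_dec (Derive f x) 0) as [Hz | Hz].
    - apply (derivative_of_locally_zero I (Derive f) x); auto.
      intros t It. generalize (Hsq t x It Ix). rewrite Hz. intros H.
      apply Rsqr_0_uniq. unfold Rsqr. lra.
    - apply (Rmult_eq_reg_l (Derive f x)); [ rewrite H0 by exact Ix; ring | exact Hz ]. }
  destruct (classic (exists x, I x)) as [[x0 Ix0] | Hemp].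
  2: { exists 0, 0. intros t It. exfalso. apply Hemp. now exists t. }
  assert (Hc : forall x, I x -> Derive f x = Derive f x0).
  { intros x Ix. apply (constant_on_interval I (Derive f) HI); auto.
    intros y Iy. rewrite <- (H2 y Iy). now apply Dp. }
  exists (Derive f x0), (f x0 - Derive f x0 * x0). intros t It.
  enough (H : f t - Derive f x0 * t = f x0 - Derive f x0 * x0) by lra.
  apply (constant_on_interval I (fun t => f t - Derive f x0 * t) HI); auto.
  intros x Ix. auto_derive; [ eexists; now apply Df | ].
  replace (Derive (fun x : R => f x) x) with (Derive f x0)
    by (symmetry; now apply Hc).
  ring.
Qed.

Lemma open_curved_part :
  forall (I : R -> Prop) (f : R -> R),
    open I -> smooth_on I f ->
    open (fun x => I x /\ Derive f x * Derive_n f 2 x <> 0).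
Proof.
  intros I f HI Hf x [Ix Hx].
  assert (Hc : continuous (fun x => Derive f x * Derive_n f 2 x) x).
  { apply (continuous_mult (Derive f) (Derive_n f 2)).
    - apply (ex_derive_continuous (Derive f)). exact (Hf 2%nat x Ix).
    - apply (ex_derive_continuous (Derive_n f 2)). exact (Hf 3%nat x Ix). }
  apply filter_and; [ now apply HI | ].
  apply (Hc (fun z => z <> 0)). now apply open_neq.
Qed.

(** The graph equation of u = f + g multiplied by (1 + f'^2 + g'^2)^(3/2),
    with S sqrt S in place of the real power. *)
Definition translation_equation (alpha lambda : R) (I J : R -> Prop)
    (f g : R -> R) : Prop :=
  forall x y, I x -> J y ->
    (1 + Derive g y ^ 2) * Derive_n f 2 x + (1 + Derive f x ^ 2) * Derive_n g 2 y
    = alpha * ((f x - x * Derive f x) + (g y - y * Derive g y))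
        * (1 + Derive f x ^ 2 + Derive g y ^ 2)
      + lambda * ((1 + Derive f x ^ 2 + Derive g y ^ 2)
                  * sqrt (1 + Derive f x ^ 2 + Derive g y ^ 2)).

Lemma translation_equation_linear :
  forall (alpha lambda : R) (I J : R -> Prop) (f g : R -> R),
    alpha <> 0 -> is_open_interval I -> is_open_interval J ->
    smooth_on I f -> smooth_on J g ->
    translation_equation alpha lambda I J f g ->
    linear_on I f \/ linear_on J g.
Proof.
  intros alpha lambda I J f g Ha HI HJ Hf Hg Heq.
  destruct (linear_or_curved I f HI Hf) as [ | [x0 Hx0]]; [ now left | ].
  destruct (linear_or_curved J g HJ Hg) as [ | [y0 Hy0]]; [ now right | exfalso ].
  apply (no_two_curved_profiles
    (fun x => I x /\ Derive f x * Derive_n f 2 x <> 0)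
    (fun y => J y /\ Derive g y * Derive_n g 2 y <> 0)
    f (Derive f) (Derive_n f 2) g (Derive g) (Derive_n g 2) (Derive_n g 3)
    alpha lambda x0 y0); auto.
  - apply open_curved_part; [ now apply open_interval_open | exact Hf ].
  - apply open_curved_part; [ now apply open_interval_open | exact Hg ].
  - intros x [Ix _]. apply Derive_correct. exact (Hf 1%nat x Ix).
  - intros x [Ix _]. apply (Derive_correct (Derive f)). exact (Hf 2%nat x Ix).
  - intros y [Jy _]. apply Derive_correct. exact (Hg 1%nat y Jy).
  - intros y [Jy _]. apply (Derive_correct (Derive g)). exact (Hg 2%nat y Jy).
  - intros y [Jy _]. apply (Derive_correct (Derive_n g 2)). exact (Hg 3%nat y Jy).
  - intros x [_ H]. exact H.
  - intros y [_ H]. exact H.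
  - intros x y [Ix _] [Jy _]. now apply Heq.
Qed.

(** * Smoothness of sums, and graph charts *)

(** The two sides are limits of the same difference quotients. *)
Lemma Derive_plus_const :
  forall (f : R -> R) (c x : R), Derive (fun z => f z + c) x = Derive f x.
Proof.
  intros f c x. unfold Derive. apply f_equal. apply Lim_ext.
  intros h. f_equal. ring.
Qed.

Lemma Derive_const_plus :
  forall (f : R -> R) (c x : R), Derive (fun z => c + f z) x = Derive f x.
Proof.
  intros f c x. unfold Derive. apply f_equal. apply Lim_ext.
  intros h. f_equal. ring.
Qed.

Lemma smooth_on_Derive :
  forall (I : R -> Prop) (f : R -> R), smooth_on I f -> smooth_on I (Derive f).
Proof.
  intros I f Hf [ | n] x Ix; [ exact Logic.I | ].
  generalize (Hf (S (S n)) x Ix). simpl. apply ex_derive_ext.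
  intros t. symmetry. rewrite (Derive_n_comp f n 1). f_equal.
  now rewrite Nat.add_1_r.
Qed.

Lemma smooth_on_of_Derive :
  forall (I : R -> Prop) (f : R -> R),
    (forall x, I x -> ex_derive f x) -> smooth_on I (Derive f) -> smooth_on I f.
Proof.
  intros I f Hf Hd [ | [ | n]] x Ix; [ exact Logic.I | now apply Hf | ].
  generalize (Hd (S n) x Ix). simpl. apply ex_derive_ext.
  intros t. rewrite (Derive_n_comp f n 1). now rewrite Nat.add_1_r.
Qed.

Lemma smooth_on_const : forall (I : R -> Prop) (c : R), smooth_on I (fun _ => c).
Proof.
  intros I c n x _. apply ex_derive_n_const.
Qed.

Lemma smooth_on_plus_const :
  forall (I : R -> Prop) (f : R -> R) (c : R),
    smooth_on I f -> smooth_on I (fun x => f x + c).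
Proof.
  intros I f c Hf. apply smooth_on_of_Derive.
  - intros x Ix. auto_derive. exact (Hf 1%nat x Ix).
  - replace (Derive (fun x => f x + c)) with (Derive f)
      by (apply functional_extensionality; intros; now rewrite Derive_plus_const).
    now apply smooth_on_Derive.
Qed.

Lemma smooth_on_affine :
  forall (I : R -> Prop) (a b : R), smooth_on I (fun x => a * x + b).
Proof.
  intros I a b. apply smooth_on_of_Derive.
  - intros x _. now auto_derive.
  - replace (Derive (fun x => a * x + b)) with (fun _ : R => a).
    + apply smooth_on_const.
    + apply functional_extensionality. intros x. symmetry.
      apply is_derive_unique. auto_derive; [ exact Logic.I | ring ].
Qed.

Lemma smooth_on_id : forall I : R -> Prop, smooth_on I (fun x => x).
Proof.
  intros I. replace (fun x : R => x) with (fun x => 1 * x + 0).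
  - apply smooth_on_affine.
  - apply functional_extensionality. intros x. ring.
Qed.

(** Partial derivatives of f + g are again sums of this shape with one summand
    zero, which is what the induction on the order runs on. *)
Lemma smooth_on2_sum :
  forall (I J : R -> Prop) (f g : R -> R),
    smooth_on I f -> smooth_on J g -> smooth_on2 (rect I J) (sum_fun f g).
Proof.
  intros I J f g Hf Hg n s t [Is Jt]. simpl in Is, Jt.
  revert f g Hf Hg. induction n as [ | n IH]; intros f g Hf Hg.
  all: assert (Hc : continuity_2d_pt (sum_fun f g) s t).
  1, 3: apply continuity_2d_pt_plus;
    [ apply (continuity_1d_2d_pt_comp f (fun u _ => u));
      [ | apply continuity_2d_pt_id1 ]
    | apply (continuity_1d_2d_pt_comp g (fun _ v => v));
      [ | apply continuity_2d_pt_id2 ] ];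
    apply continuity_pt_filterlim; apply (@ex_derive_continuous R_AbsRing R_NormedModule);
    [ exact (Hf 1%nat s Is) | exact (Hg 1%nat t Jt) ].
  - now split.
  - split; [ exact Hc | split; [ | split; [ | split ] ] ].
    + unfold sum_fun. auto_derive. exact (Hf 1%nat s Is).
    + unfold sum_fun. auto_derive. exact (Hg 1%nat t Jt).
    + apply (ex_diff_n_ext_loc (sum_fun (Derive f) (fun _ => 0))).
      * apply locally_2d_forall. intros u v. unfold sum_fun.
        rewrite Derive_plus_const. ring.
      * apply IH; [ now apply smooth_on_Derive | apply smooth_on_const ].
    + apply (ex_diff_n_ext_loc (sum_fun (fun _ => 0) (Derive g))).
      * apply locally_2d_forall. intros u v. unfold sum_fun.
        rewrite Derive_const_plus. ring.
      * apply IH; [ apply smooth_on_const | now apply smooth_on_Derive ].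
Qed.

Lemma continuous_pair :
  forall (T U V : UniformSpace) (f : T -> U) (g : T -> V) (x : T),
    continuous f x -> continuous g x -> continuous (fun z => (f z, g z)) x.
Proof.
  intros T U V f g x Hf Hg P [eps HP].
  assert (H1 : locally x (fun z => ball (f x) eps (f z)))
    by apply Hf, locally_ball.
  assert (H2 : locally x (fun z => ball (g x) eps (g z)))
    by apply Hg, locally_ball.
  unfold filtermap. generalize (filter_and _ _ H1 H2).
  apply filter_imp. intros z Hz. apply HP. exact Hz.
Qed.

Lemma continuous_cx : forall p : R * R * R, continuous (cx : R * R * R -> R) p.
Proof.
  intros [[x y] z]. apply (continuous_comp fst fst); apply continuous_fst.
Qed.

Lemma continuous_cy : forall p : R * R * R, continuous (cy : R * R * R -> R) p.
Proof.
  intros [[x y] z].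
  apply (continuous_comp fst snd); [ apply continuous_fst | apply continuous_snd ].
Qed.

Lemma continuous_cz : forall p : R * R * R, continuous (cz : R * R * R -> R) p.
Proof.
  intros [[x y] z]. apply continuous_snd.
Qed.

(** The second coordinate is reparametrized by a global homeomorphism phi with
    inverse chi. The identity gives the chart in which the mean curvature is
    computed, a rescaling gives rulings of unit speed. *)
Lemma local_param_graph :
  forall (I J T : R -> Prop) (f g phi chi psi : R -> R),
    open I -> open T -> smooth_on I f -> smooth_on T phi -> smooth_on T psi ->
    (forall t, T t -> Derive phi t <> 0) ->
    (forall t, chi (phi t) = t) -> (forall y, phi (chi y) = y) ->
    (forall y, continuous chi y) ->
    (forall t, T t <-> J (phi t)) -> (forall t, T t -> psi t = g (phi t)) ->
    local_param (graph (rect I J) (sum_fun f g)) (rect I T)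
      (fun s t => (s, phi t, f s + psi t)).
Proof.
  intros I J T f g phi chi psi HI HT Hf Hphi Hpsi Hphi1 Hcp Hpc Hchi HTJ Hg.
  split; [ | split; [ split; [ | split ] | split; [ | split ] ] ].
  - apply open_and.
    + apply (open_comp fst); [ | exact HI ]. intros [u v] _. apply continuous_fst.
    + apply (open_comp snd); [ | exact HT ]. intros [u v] _. apply continuous_snd.
  - generalize (smooth_on2_sum I T (fun s => s) (fun _ => 0)
                  (smooth_on_id I) (smooth_on_const T 0)).
    replace (sum_fun (fun s => s) (fun _ => 0)) with (fun s _ : R => s); [ easy | ].
    apply functional_extensionality. intros s.
    apply functional_extensionality. intros t. unfold sum_fun. ring.
  - generalize (smooth_on2_sum I T (fun _ => 0) phi (smooth_on_const I 0) Hphi).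
    replace (sum_fun (fun _ => 0) phi) with (fun _ t : R => phi t); [ easy | ].
    apply functional_extensionality. intros s.
    apply functional_extensionality. intros t. unfold sum_fun. ring.
  - exact (smooth_on2_sum I T f psi Hf Hpsi).
  - intros s t [Is Tt] a b Hab. unfold D1, D2 in Hab. simpl in Hab.
    injection Hab as Hx Hy _.
    change (a * Derive (fun r => r) s + b * Derive (fun _ => s) t = 0) in Hx.
    change (a * Derive (fun _ => phi t) s + b * Derive phi t = 0) in Hy.
    rewrite Derive_id, Derive_const in Hx. rewrite Derive_const in Hy.
    split; [ lra | ].
    apply (Rmult_eq_reg_r (Derive phi t)); [ lra | now apply Hphi1 ].
  - intros s t s' t' _ _ H. injection H as Hs Ht _. split; [ exact Hs | ].
    rewrite <- (Hcp t), <- (Hcp t'). now rewrite Ht.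
  - intros O HO HOW.
    exists (fun p => O (cx p, chi (cy p))). split.
    + apply (open_comp (fun p : R * R * R => (cx p, chi (cy p)))); [ | exact HO ].
      intros p _. apply (continuous_pair _ _ _ (cx : R * R * R -> R)
                           (fun p : R * R * R => chi (cy p))).
      * apply continuous_cx.
      * apply (continuous_comp (cy : R * R * R -> R) chi);
          [ apply continuous_cy | apply Hchi ].
    + intros [[x y] z]. unfold graph, cx, cy, cz; simpl. split.
      * intros (s & t & HOst & Heq). injection Heq as <- <- <-.
        destruct (HOW _ HOst) as [Is Tt]. simpl in Is, Tt.
        rewrite Hcp. repeat split; simpl; auto.
        -- now apply HTJ.
        -- unfold sum_fun. now rewrite Hg.
      * intros [[[Ix Jy] Hz] HOp]. simpl in Ix, Jy.
        exists x, (chi y). split; [ exact HOp | ].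
        rewrite Hpc, Hz. unfold sum_fun. rewrite Hg, Hpc; [ reflexivity | ].
        apply HTJ. now rewrite Hpc.
Qed.

(** * From self-similarity to the translation equation *)

Lemma self_similar_translation_equation :
  forall (alpha lambda : R) (I J : R -> Prop) (f g : R -> R),
    is_open_interval I -> is_open_interval J ->
    smooth_on I f -> smooth_on J g ->
    self_similar alpha lambda
      (graph (rect I J) (sum_fun f g)) (graph_normal (sum_fun f g)) ->
    translation_equation alpha lambda I J f g.
Proof.
  intros alpha lambda I J f g HI HJ Hf Hg (_ & _ & Heq) x y Ix Jy.
  set (X := fun s t : R => (s, t, f s + g t) : R3).
  assert (HX : local_param (graph (rect I J) (sum_fun f g)) (rect I J) X).
  { apply (local_param_graph I J J f g (fun t => t) (fun t => t) g);
      auto using open_interval_open.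
    - apply smooth_on_id.
    - intros t _. rewrite Derive_id. lra.
    - intros t. apply continuous_id.
    - easy. }
  assert (E1 : forall s t, D1 X s t = (1, 0, Derive f s)).
  { intros s t. unfold D1, X, cx, cy, cz; simpl.
    now rewrite Derive_id, Derive_const, Derive_plus_const. }
  assert (E2 : forall s t, D2 X s t = (0, 1, Derive g t)).
  { intros s t. unfold D2, X, cx, cy, cz; simpl.
    now rewrite Derive_id, Derive_const, Derive_const_plus. }
  assert (E1' : D1 X = fun s t => (1, 0, Derive f s)).
  { apply functional_extensionality. intros s.
    apply functional_extensionality. apply E1. }
  assert (E2' : D2 X = fun s t => (0, 1, Derive g t)).
  { apply functional_extensionality. intros s.
    apply functional_extensionality. apply E2. }
  assert (E11 : D1 (D1 X) x y = (0, 0, Derive_n f 2 x)).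
  { rewrite E1'. unfold D1, cx, cy, cz; simpl. now rewrite !Derive_const. }
  assert (E12 : D2 (D1 X) x y = (0, 0, 0)).
  { rewrite E1'. unfold D2, cx, cy, cz; simpl. now rewrite !Derive_const. }
  assert (E22 : D2 (D2 X) x y = (0, 0, Derive_n g 2 y)).
  { rewrite E2'. unfold D2, cx, cy, cz; simpl. now rewrite !Derive_const. }
  generalize (Heq _ X HX x y (conj Ix Jy)).
  unfold mean_curvature. rewrite E11, E12, E22, E1, E2.
  unfold graph_normal, X, dot, cx, cy, cz, sum_fun; cbn [fst snd].
  rewrite Derive_plus_const, Derive_const_plus.
  rewrite <- Rplus_assoc.
  generalize (Derive f x) (Derive g y) (Derive_n f 2 x) (Derive_n g 2 y).
  intros p q p1 q1 H.
  assert (HS : 0 < 1 + p ^ 2 + q ^ 2)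
    by (generalize (pow2_ge_0 p) (pow2_ge_0 q); lra).
  assert (HT := sqrt_lt_R0 _ HS).
  assert (HTT := sqrt_sqrt _ (Rlt_le _ _ HS)).
  revert H HT HTT. generalize (sqrt (1 + p ^ 2 + q ^ 2)). intros T H HT HTT.
  match type of H with ?l = _ =>
    assert (Hl : l = ((1 + q ^ 2) * p1 + (1 + p ^ 2) * q1) / (T * (1 + p ^ 2 + q ^ 2)))
  end.
  { field. lra. }
  rewrite Hl in H.
  apply (Rmult_eq_reg_r (/ (T * (1 + p ^ 2 + q ^ 2)))).
  2: { apply Rinv_neq_0_compat. apply Rmult_integral_contrapositive_currified; lra. }
  unfold Rdiv in H at 1. rewrite H. field. lra.
Qed.

(** * Linear isometries and the exchange of x and y *)

Lemma norm_R3 : forall u : R3, norm (u : R * R * R) = sqrt (dot u u).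
Proof.
  intros [[x y] z].
  change (sqrt (sqrt (Rabs x ^ 2 + Rabs y ^ 2) ^ 2 + Rabs z ^ 2)
          = sqrt (x * x + y * y + z * z)).
  f_equal. rewrite pow2_sqrt, !pow2_abs; [ ring | ].
  generalize (pow2_ge_0 (Rabs x)) (pow2_ge_0 (Rabs y)). lra.
Qed.

Lemma linear_isometry_intro :
  forall Phi : R3 -> R3,
    (forall u v : R * R * R, Phi (plus u v) = plus (Phi u : R * R * R) (Phi v)) ->
    (forall (c : R) (u : R * R * R), Phi (scal c u) = scal c (Phi u : R * R * R)) ->
    (forall u : R3, dot (Phi u) (Phi u) = dot u u) ->
    linear_isometry Phi.
Proof.
  intros Phi Hplus Hscal Hdot.
  assert (Hn : forall u : R3, norm (Phi u : R * R * R) = norm (u : R * R * R)).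
  { intros u. rewrite !norm_R3. now rewrite Hdot. }
  split; [ split | exact Hn ]; auto.
  exists 1. split; [ lra | ]. intros u. rewrite Rmult_1_l. right. apply Hn.
Qed.

Lemma linear_isometry_comp :
  forall Phi Psi : R3 -> R3,
    linear_isometry Phi -> linear_isometry Psi ->
    linear_isometry (fun p => Psi (Phi p)).
Proof.
  intros Phi Psi [HP HPn] [HQ HQn]. split.
  - exact (is_linear_comp _ _ HP HQ).
  - intros u. now rewrite HQn.
Qed.

Definition swap (p : R3) : R3 := (cy p, cx p, cz p).

Lemma swap_isometry : linear_isometry swap.
Proof.
  apply linear_isometry_intro.
  - intros [[x y] z] [[x' y'] z']. reflexivity.
  - intros c [[x y] z]. reflexivity.
  - intros [[x y] z]. unfold dot, swap, cx, cy, cz. simpl. ring.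
Qed.

Lemma swap_involutive : forall p, swap (swap p) = p.
Proof. now intros [[x y] z]. Qed.

Lemma graph_swap :
  forall (I J : R -> Prop) (f g : R -> R) (p : R3),
    graph (rect I J) (sum_fun f g) p
    <-> graph (rect J I) (sum_fun g f) (swap p).
Proof.
  intros I J f g [[x y] z]. unfold graph, rect, sum_fun, swap, cx, cy, cz. simpl.
  rewrite (Rplus_comm (g y)). tauto.
Qed.

Lemma local_param_swap :
  forall (M M' : R3 -> Prop) (W : R * R -> Prop) (X : R -> R -> R3),
    (forall p, M p <-> M' (swap p)) ->
    local_param M' W X -> local_param M W (fun s t => swap (X s t)).
Proof.
  intros M M' W X HM (HW & (Hx & Hy & Hz) & Himm & Hinj & Hopen).
  split; [ exact HW | split; [ now split | split; [ | split ] ] ].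
  - intros s t Wst a b Hab. apply (Himm s t Wst a b).
    unfold D1, D2 in *. simpl in Hab |- *.
    injection Hab as H1 H2 H3.
    apply (f_equal2 pair); [ now apply (f_equal2 pair) | exact H3 ].
  - intros s t s' t' Wst Wst' E. apply (Hinj s t s' t' Wst Wst').
    now rewrite <- (swap_involutive (X s t)), E, swap_involutive.
  - intros O HO HOW. destruct (Hopen O HO HOW) as (V & HV & HVeq).
    exists (fun p => V (swap p)). split.
    + apply (open_comp (swap : R * R * R -> R * R * R)); [ | exact HV ].
      intros p _.
      apply (continuous_pair _ _ _ (fun p : R * R * R => (cy p, cx p))
               (cz : R * R * R -> R)); [ | apply continuous_cz ].
      apply (continuous_pair _ _ _ (cy : R * R * R -> R) (cx : R * R * R -> R));
        [ apply continuous_cy | apply continuous_cx ].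
    + intros p. rewrite HM, <- HVeq. split; intros (s & t & HOst & E);
        exists s, t; (split; [ exact HOst | ]).
      * now rewrite <- E, swap_involutive.
      * now rewrite E, swap_involutive.
Qed.

Lemma cylindrical_swap :
  forall M M' : R3 -> Prop,
    (forall p, M p <-> M' (swap p)) -> cylindrical M' -> cylindrical M.
Proof.
  intros M M' HM (w & Hw). exists (swap w). intros p Mp.
  destruct (Hw (swap p)) as
    (S & T & gamma & beta & (HS & HT & (Hg1 & Hg2 & Hg3) & (Hb1 & Hb2 & Hb3) & Hn & HX)
     & Hbw & s & t & Ss & Tt & E); [ now apply HM | ].
  exists S, T, (fun s => swap (gamma s)), (fun s => swap (beta s)).
  split; [ | split ].
  - split; [ exact HS | split; [ exact HT | split; [ now split | split; [ now split | ] ] ] ].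
    split.
    + intros r Sr. rewrite <- (Hn r Sr). apply (proj2 swap_isometry).
    + exact (local_param_swap M M' (rect S T) (ruled_map gamma beta) HM HX).
  - intros r Sr. now rewrite Hbw.
  - exists s, t. split; [ exact Ss | split; [ exact Tt | ] ].
    rewrite <- (swap_involutive p), <- E. reflexivity.
Qed.

(** * Surfaces with one linear profile *)

(** The rulings are the curves s = const, with unit direction
    (0, 1, a) / k for k = sqrt (1 + a^2); at parameter t the point has
    y-coordinate t / k, so t ranges over the interval J scaled by k. *)
Lemma graph_linear_cylindrical :
  forall (I J : R -> Prop) (f g : R -> R),
    is_open_interval I -> is_open_interval J -> smooth_on I f ->
    linear_on J g -> cylindrical (graph (rect I J) (sum_fun f g)).
Proof.
  intros I J f g HI HJ Hf (a & b & Hg).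
  pose (k := sqrt (1 + a ^ 2)).
  assert (Hk2 : k * k = 1 + a ^ 2)
    by (apply sqrt_sqrt; generalize (pow2_ge_0 a); lra).
  assert (Hk : 0 < k) by (apply sqrt_lt_R0; generalize (pow2_ge_0 a); lra).
  exists (0, / k, a * / k). intros [[x y] z] [[Ix Jy] Hz].
  unfold cx, cy, cz in Ix, Jy, Hz; cbn [fst snd] in Ix, Jy, Hz.
  exists I, (fun t => J (t * / k)), (fun s => (s, 0, f s + b)),
    (fun _ => (0, / k, a * / k)).
  assert (HT := open_interval_scale J k Hk HJ).
  split; [ | split ].
  - split; [ exact HI | split; [ exact HT | split; [ | split; [ | split ] ] ] ].
    + split; [ | split ].
      * exact (smooth_on_id I).
      * exact (smooth_on_const I 0).
      * exact (smooth_on_plus_const I f b Hf).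
    + split; [ | split ]; exact (smooth_on_const I _).
    + intros s _. rewrite norm_R3.
      replace (dot _ _) with 1; [ apply sqrt_1 | ].
      unfold dot, cx, cy, cz; cbn [fst snd].
      replace (0 * 0 + / k * / k + a * / k * (a * / k))
        with ((1 + a ^ 2) * / (k * k)) by (field; lra).
      rewrite <- Hk2. field. lra.
    + replace (ruled_map (fun s => (s, 0, f s + b)) (fun _ => (0, / k, a * / k)))
        with (fun s t => (s, / k * t + 0, f s + ((a * / k) * t + b)) : R3).
      * apply (local_param_graph I J _ f g (fun t => / k * t + 0) (fun y => k * y)
                 (fun t => (a * / k) * t + b)).
        -- now apply open_interval_open.
        -- now apply open_interval_open.
        -- exact Hf.
        -- apply smooth_on_affine.
        -- apply smooth_on_affine.
        -- intros t _.
           replace (Derive _ t) with (/ k); [ apply Rinv_neq_0_compat; lra | ].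
           symmetry. apply is_derive_unique. auto_derive; [ exact Logic.I | ring ].
        -- intros t. field. lra.
        -- intros t. field. lra.
        -- intros t. apply (continuous_mult (fun _ => k) (fun t => t));
             [ apply continuous_const | apply continuous_id ].
        -- intros t. replace (/ k * t + 0) with (t * / k) by ring. tauto.
        -- intros t Jt. rewrite Hg; [ ring | ].
           replace (/ k * t + 0) with (t * / k) by ring. exact Jt.
      * apply functional_extensionality. intros s.
        apply functional_extensionality. intros t.
        change ((s, / k * t + 0, f s + ((a * / k) * t + b))
                = (s + t * 0, 0 + t * / k, (f s + b) + t * (a * / k))).
        f_equal; [ f_equal | ]; ring.
  - reflexivity.
  - exists x, (k * y). split; [ exact Ix | ].
    split; [ now replace (k * y * / k) with y by (field; lra) | ].
    change ((x + k * y * 0, 0 + k * y * / k, (f x + b) + k * y * (a * / k))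
            = (x, y, z)).
    rewrite Hz. unfold sum_fun. rewrite Hg by exact Jy.
    f_equal; [ f_equal | ]; field; lra.
Qed.

Lemma Rpower_3_2 : forall S, 0 < S -> Rpower S (3 / 2) = S * sqrt S.
Proof.
  intros S HS. replace (3 / 2) with (1 + / 2) by field.
  now rewrite Rpower_plus, Rpower_1, Rpower_sqrt.
Qed.

Definition profile_equation (alpha lambda : R) (I : R -> Prop) (F : R -> R) : Prop :=
  forall x : R, I x ->
    Derive_n F 2 x / Rpower (1 + Derive F x ^ 2) (3 / 2)
    = alpha * ((- x * Derive F x + F x) / sqrt (1 + Derive F x ^ 2)) + lambda.

(** With k = sqrt (1 + a^2) and F = (f + b) / k one has
    1 + F'^2 = (k^2 + f'^2) / k^2, so the powers of k cancel on both sides. *)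
Lemma profile_of_translation_equation :
  forall (alpha lambda : R) (I J : R -> Prop) (f g : R -> R) (a b : R),
    is_open_interval J -> smooth_on I f ->
    (forall t, J t -> g t = a * t + b) ->
    translation_equation alpha lambda I J f g ->
    profile_equation alpha lambda I (fun x => / sqrt (1 + a ^ 2) * (f x + b)).
Proof.
  intros alpha lambda I J f g a b HJ Hf Hg Heq x Ix.
  destruct (open_interval_inhabited J HJ) as [y Jy].
  assert (Hloc : locally y (fun t => g t = a * t + b)).
  { apply (filter_imp J); [ exact Hg | now apply open_interval_open ]. }
  assert (Hd : forall t, Derive (fun t => a * t + b) t = a).
  { intros t. apply is_derive_unique. auto_derive; [ exact Logic.I | ring ]. }
  assert (Hg1 : Derive g y = a).
  { rewrite (Derive_ext_loc g (fun t => a * t + b) y Hloc). apply Hd. }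
  assert (Hg2 : Derive_n g 2 y = 0).
  { rewrite (Derive_n_ext_loc g (fun t => a * t + b) 2 y Hloc).
    simpl. rewrite (Derive_ext _ (fun _ => a)); [ apply Derive_const | exact Hd ]. }
  generalize (Heq x y Ix Jy). rewrite Hg1, Hg2, (Hg y Jy). clear Heq.
  set (k := sqrt (1 + a ^ 2)).
  assert (Hk2 : k * k = 1 + a ^ 2)
    by (apply sqrt_sqrt; generalize (pow2_ge_0 a); lra).
  assert (Hk : 0 < k) by (apply sqrt_lt_R0; generalize (pow2_ge_0 a); lra).
  assert (HF1 : forall t, Derive (fun x => / k * (f x + b)) t = / k * Derive f t).
  { intros t. now rewrite Derive_scal, Derive_plus_const. }
  assert (HF2 : Derive_n (fun x => / k * (f x + b)) 2 x = / k * Derive_n f 2 x).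
  { change (Derive (Derive (fun x => / k * (f x + b))) x = / k * Derive (Derive f) x).
    rewrite (Derive_ext _ (fun t => / k * Derive f t)); [ apply Derive_scal | exact HF1 ]. }
  rewrite HF2, HF1.
  generalize (Derive f x) (Derive_n f 2 x). intros p p1 H.
  assert (HS : 0 < 1 + p ^ 2 + a ^ 2)
    by (generalize (pow2_ge_0 p) (pow2_ge_0 a); lra).
  assert (HT := sqrt_lt_R0 _ HS).
  assert (HTT := sqrt_sqrt _ (Rlt_le _ _ HS)).
  assert (HE : 1 + (/ k * p) ^ 2 = (1 + p ^ 2 + a ^ 2) * / (k * k)).
  { replace (1 + p ^ 2 + a ^ 2) with (k * k + p ^ 2) by lra. field. lra. }
  assert (HE' : sqrt (1 + (/ k * p) ^ 2) = sqrt (1 + p ^ 2 + a ^ 2) * / k).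
  { rewrite HE, sqrt_mult_alt by lra. f_equal.
    rewrite <- Rsqr_def, sqrt_inv, sqrt_Rsqr; lra. }
  assert (Hpos : 0 < 1 + (/ k * p) ^ 2)
    by (generalize (pow2_ge_0 (/ k * p)); lra).
  rewrite Rpower_3_2 by exact Hpos. rewrite HE', HE.
  revert H HT HTT. generalize (sqrt (1 + p ^ 2 + a ^ 2)). intros T H HT HTT.
  apply (Rmult_eq_reg_r ((1 + p ^ 2 + a ^ 2) * T)).
  2: { apply Rmult_integral_contrapositive_currified; lra. }
  transitivity (k * k * p1); [ field; lra | ].
  transitivity ((1 + a ^ 2) * p1 + (1 + p ^ 2) * 0); [ rewrite Hk2; ring | ].
  rewrite H. field. lra.
Qed.

(** The rotation about the x-axis that takes the ruling direction (0, 1, a) to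
    the y-axis and the normal direction (0, - a, 1) to the z-axis. *)
Definition tilt (a : R) (p : R3) : R3 :=
  let k := sqrt (1 + a ^ 2) in
  (cx p, / k * (cy p + a * cz p), / k * (cz p - a * cy p)).

Lemma tilt_isometry : forall a : R, linear_isometry (tilt a).
Proof.
  intros a. unfold tilt.
  set (k := sqrt (1 + a ^ 2)).
  assert (Hk2 : k * k = 1 + a ^ 2)
    by (apply sqrt_sqrt; generalize (pow2_ge_0 a); lra).
  assert (Hk : 0 < k) by (apply sqrt_lt_R0; generalize (pow2_ge_0 a); lra).
  apply linear_isometry_intro.
  - intros [[x y] z] [[x' y'] z'].
    change ((x + x', / k * ((y + y') + a * (z + z')), / k * ((z + z') - a * (y + y')))
      = (x + x', / k * (y + a * z) + / k * (y' + a * z'),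
         / k * (z - a * y) + / k * (z' - a * y'))).
    f_equal; [ f_equal | ]; ring.
  - intros c [[x y] z].
    change ((c * x, / k * (c * y + a * (c * z)), / k * (c * z - a * (c * y)))
      = (c * x, c * (/ k * (y + a * z)), c * (/ k * (z - a * y)))).
    f_equal; [ f_equal | ]; ring.
  - intros [[x y] z]. unfold dot, cx, cy, cz; cbn [fst snd].
    transitivity (x * x + (1 + a ^ 2) * / (k * k) * (y * y + z * z)); [ field; lra | ].
    rewrite <- Hk2. field. lra.
Qed.

(** The last conclusion of the theorem as a property of a surface, so that it
    can be transported along [swap]. *)
Definition has_cylinder_form (alpha lambda : R) (M : R3 -> Prop) : Prop :=
  exists (Phi : R3 -> R3) (I' : R -> Prop) (W : R * R -> Prop) (F G : R -> R),
    linear_isometry Phi /\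
    is_open_interval I' /\ smooth_on I' F /\ (forall y : R, G y = 0) /\
    open W /\ (forall x : R, I' x <-> exists y : R, W (x, y)) /\
    (forall p : R3, image Phi M p <-> graph W (sum_fun F G) p) /\
    profile_equation alpha lambda I' F.

(** Over each x in I the tilted graph lies over the interval of those v for which
    the y-coordinate h x v of the preimage is in J; the new domain is open
    because h is continuous, and it projects onto I because J is inhabited. *)
Lemma graph_linear_cylinder_form :
  forall (alpha lambda : R) (I J : R -> Prop) (f g : R -> R),
    is_open_interval I -> is_open_interval J -> smooth_on I f ->
    linear_on J g -> translation_equation alpha lambda I J f g ->
    has_cylinder_form alpha lambda (graph (rect I J) (sum_fun f g)).
Proof.
  intros alpha lambda I J f g HI HJ Hf (a & b & Hg) Heq.
  assert (Hode := profile_of_translation_equation alpha lambda I J f g a b HJ Hf Hg Heq).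
  set (k := sqrt (1 + a ^ 2)) in *.
  assert (Hk2 : k * k = 1 + a ^ 2)
    by (apply sqrt_sqrt; generalize (pow2_ge_0 a); lra).
  assert (Hk : 0 < k) by (apply sqrt_lt_R0; generalize (pow2_ge_0 a); lra).
  (* the y-coordinate of the point that [tilt a] sends above (u, v) *)
  pose (h := fun u v : R => / k * (v - a * (/ k * (f u + b)))).
  exists (tilt a), I, (fun q => I (fst q) /\ J (h (fst q) (snd q))),
    (fun x => / k * (f x + b)), (fun _ => 0).
  split; [ apply tilt_isometry | split; [ exact HI | split; [ | split; [ easy | ] ] ] ].
  { apply smooth_on_of_Derive.
    - intros x Ix. auto_derive. exact (Hf 1%nat x Ix).
    - intros n x Ix.
      apply (ex_derive_n_ext (fun t => / k * Derive f t)).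
      + intros t. now rewrite Derive_scal, Derive_plus_const.
      + apply ex_derive_n_scal_l. exact (smooth_on_Derive I f Hf n x Ix). }
  split; [ | split; [ | split; [ | exact Hode ] ] ].
  - intros [u v] [Iu Jh]; cbn [fst snd] in Iu, Jh.
    assert (HfstI : locally (u, v) (fun q : R * R => I (fst q))).
    { apply (continuous_fst u v I). now apply (open_interval_open I HI). }
    assert (Hc : continuous (fun q : R * R => h (fst q) (snd q)) (u, v)).
    { unfold h.
      apply (continuous_mult (fun _ => / k)
        (fun q : R * R => snd q - a * (/ k * (f (fst q) + b))));
        [ apply continuous_const | ].
      apply (continuous_minus (fun q : R * R => snd q)
        (fun q : R * R => a * (/ k * (f (fst q) + b)))); [ apply continuous_snd | ].
      apply (continuous_comp (fun q : R * R => fst q)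
        (fun x => a * (/ k * (f x + b)))); [ apply continuous_fst | ].
      apply (@ex_derive_continuous R_AbsRing R_NormedModule).
      auto_derive. exact (Hf 1%nat u Iu). }
    apply filter_and; [ exact HfstI | ].
    apply (Hc J). now apply (open_interval_open J HJ).
  - intros x. split.
    + intros Ix. destruct (open_interval_inhabited J HJ) as [y Jy].
      exists (k * y + a * (/ k * (f x + b))). split; [ exact Ix | ].
      unfold h; cbn [fst snd].
      replace (/ k * _) with y by (field; lra). exact Jy.
    + intros (y & Ix & _). exact Ix.
  - intros [[X Y] Z]. split.
    + intros ([[x y] z] & [[Ix Jy] Hz] & E).
      unfold cx, cy, cz in Ix, Jy, Hz; cbn [fst snd] in Ix, Jy, Hz.
      unfold sum_fun in Hz. rewrite (Hg y Jy) in Hz.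
      unfold tilt, cx, cy, cz in E; cbn [fst snd] in E. fold k in E.
      injection E as <- <- <-.
      assert (Ey : h x (/ k * (y + a * z)) = y).
      { unfold h. rewrite Hz.
        transitivity ((1 + a ^ 2) * / (k * k) * y); [ field; lra | ].
        rewrite <- Hk2. field. lra. }
      unfold graph, sum_fun, cx, cy, cz; cbn [fst snd]. rewrite Ey.
      split; [ now split | rewrite Hz; ring ].
    + unfold graph, sum_fun, cx, cy, cz; cbn [fst snd]. intros [[IX Jh] HZ].
      exists (X, / k * (Y - a * Z), / k * (a * Y + Z)). split.
      * assert (Ey : h X Y = / k * (Y - a * Z)) by (unfold h; rewrite HZ; ring).
        unfold graph, rect, sum_fun, cx, cy, cz; cbn [fst snd].
        rewrite <- Ey, (Hg _ Jh), Ey. repeat split; [ exact IX | now rewrite <- Ey | ].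
        apply (Rmult_eq_reg_l k); [ | lra ].
        transitivity (a * Y - a ^ 2 * Z + (1 + a ^ 2) * Z); [ field; lra | ].
        rewrite <- Hk2, HZ. field. lra.
      * unfold tilt, cx, cy, cz; cbn [fst snd]. fold k.
        f_equal; [ f_equal | ].
        -- transitivity ((1 + a ^ 2) * / (k * k) * Y); [ field; lra | ].
           rewrite <- Hk2. field. lra.
        -- transitivity ((1 + a ^ 2) * / (k * k) * Z); [ field; lra | ].
           rewrite <- Hk2. field. lra.
Qed.

Lemma has_cylinder_form_swap :
  forall (alpha lambda : R) (M M' : R3 -> Prop),
    (forall p, M p <-> M' (swap p)) ->
    has_cylinder_form alpha lambda M' -> has_cylinder_form alpha lambda M.
Proof.
  intros alpha lambda M M' HM (Phi & I' & W & F & G & HPhi & HI & HF & HG & HW & HIW & Him & Hode).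
  exists (fun p => Phi (swap p)), I', W, F, G.
  split; [ exact (linear_isometry_comp swap Phi swap_isometry HPhi) | ].
  do 5 (split; [ assumption | ]).
  split; [ | exact Hode ].
  intros p. rewrite <- Him. split.
  - intros (q & Mq & E). exists (swap q). split; [ now apply HM | exact E ].
  - intros (q & Mq & E). exists (swap q).
    split; [ apply HM | ]; now rewrite swap_involutive.
Qed.

Lemma translation_equation_sym :
  forall (alpha lambda : R) (I J : R -> Prop) (f g : R -> R),
    translation_equation alpha lambda I J f g ->
    translation_equation alpha lambda J I g f.
Proof.
  intros alpha lambda I J f g H y x Jy Ix. generalize (H x y Ix Jy).
  replace (1 + Derive g y ^ 2 + Derive f x ^ 2)
    with (1 + Derive f x ^ 2 + Derive g y ^ 2) by ring.
  intros E. rewrite Rplus_comm, E. ring.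
Qed.

Theorem theorem1p3 :
  forall (alpha lambda : R) (I J : R -> Prop) (f g : R -> R),
    alpha <> 0 ->
    is_open_interval I -> is_open_interval J ->
    smooth_on I f -> smooth_on J g ->
    self_similar alpha lambda
      (graph (rect I J) (sum_fun f g)) (graph_normal (sum_fun f g)) ->
    (linear_on I f \/ linear_on J g) /\
    cylindrical (graph (rect I J) (sum_fun f g)) /\
    exists (Phi : R3 -> R3) (I' : R -> Prop) (W : R * R -> Prop)
           (F G : R -> R),
      linear_isometry Phi /\
      is_open_interval I' /\ smooth_on I' F /\ (forall y : R, G y = 0) /\
      open W /\ (forall x : R, I' x <-> exists y : R, W (x, y)) /\
      (forall p : R3,
         image Phi (graph (rect I J) (sum_fun f g)) p <->
         graph W (sum_fun F G) p) /\
      (forall x : R, I' x ->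
         Derive_n F 2 x / Rpower (1 + Derive F x ^ 2) (3 / 2)
         = alpha * ((- x * Derive F x + F x) / sqrt (1 + Derive F x ^ 2))
           + lambda).
Proof.
  intros alpha lambda I J f g Ha HI HJ Hf Hg Hself.
  assert (Heq := self_similar_translation_equation alpha lambda I J f g
                   HI HJ Hf Hg Hself).
  assert (Hlin := translation_equation_linear alpha lambda I J f g
                    Ha HI HJ Hf Hg Heq).
  split; [ exact Hlin | ].
  change (cylindrical (graph (rect I J) (sum_fun f g)) /\
          has_cylinder_form alpha lambda (graph (rect I J) (sum_fun f g))).
  destruct Hlin as [Hlf | Hlg].
  - assert (HM := graph_swap I J f g). split.
    + apply (cylindrical_swap _ _ HM). now apply graph_linear_cylindrical.
    + apply (has_cylinder_form_swap _ _ _ _ HM).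
      apply graph_linear_cylinder_form; auto. now apply translation_equation_sym.
  - split; [ now apply graph_linear_cylindrical | now apply graph_linear_cylinder_form ].
Qed.
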